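(* Let $(X,d)$ be a CAT(0) space, let $C$ be a nonempty convex subset of $X$, let $x\in X$ and $u\in C$. Then $u=P_Cx$ if and only if $$\langle\overrightarrow{xu},\overrightarrow{uy}\rangle\geq 0\quad\text{for all } y\in C.$$
   Context: A CAT(0) space is a geodesically connected metric space $(X,d)$ in which every geodesic triangle is at least as thin as its comparison triangle in the Euclidean plane; completeness of $X$ is not assumed. Any two points $x,y\in X$ are joined by a unique geodesic segment, denoted $[x,y]$. A subset $C\subseteq X$ is convex if $[x,y]\subseteq C$ for all $x,y\in C$. Quasilinearization (Berg–Nikolaev): a pair $(a,b)\in X\times X$ is denoted $\overrightarrow{ab}$, and for $a,b,c,d\in X$ (here $d(\cdot,\cdot)$ is the metric), $$\langle\overrightarrow{ab},\overrightarrow{cd}\rangle=\tfrac12\left(d^2(a,d)+d^2(b,c)-d^2(a,c)-d^2(b,d)\right),$$ where $d^2(p,q)$ means $(d(p,q))^2$. Metric projection: $u=P_Cx$ means that $u$ is the unique point of $C$ satisfying $d(x,u)=\min_{y\in C}d(x,y)$. (For convex $C$ such a point is unique if it exists; it always exists if $C$ is nonempty, convex and complete.) *)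

(* Defs.v *)
From mathcomp Require Import all_boot all_order all_algebra.
From mathcomp Require Import classical_sets reals topology.

Set Implicit Arguments.
Unset Strict Implicit.
Unset Printing Implicit Defensive.

Import Order.TTheory GRing.Theory Num.Theory.

Local Open Scope ring_scope.
Local Open Scope classical_set_scope.

(* The library's norm on row vectors is the sup norm, hence the explicit
   Euclidean distance. *)
Definition eucl_dist (R : realType) (a b : 'rV[R]_2) : R :=
  Num.sqrt (\sum_(i < 2) (a ord0 i - b ord0 i) ^+ 2).

Definition eucl_segment (R : realType) (a b : 'rV[R]_2) : set 'rV[R]_2 :=
  [set (1 - t) *: a + t *: b | t in `[0, 1]].

(* Only the restriction of [c] to [0, d(x, y)] is meaningful. *)
Definition geodesic_path (R : realType) (X : metricType R)
    (c : R -> X) (x y : X) : Prop :=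
  [/\ c 0 = x, c (mdist x y) = y &
      forall s t, 0 <= s <= mdist x y -> 0 <= t <= mdist x y ->
        mdist (c s) (c t) = `|s - t|].

Definition geodesic_segment (R : realType) (X : metricType R)
    (x y : X) (S : set X) : Prop :=
  exists2 c : R -> X, geodesic_path c x y & S = c @` `[0, mdist x y].

Definition geodesic_space (R : realType) (X : metricType R) : Prop :=
  forall x y : X, exists S, geodesic_segment x y S.

(* A triangle has vertices [v 0, v 1, v 2]; its side [S i] joins [v i] to the
   cyclically next vertex [v (ordS i)]. *)
Definition geodesic_triangle (R : realType) (X : metricType R)
    (v : 'I_3 -> X) (S : 'I_3 -> set X) : Prop :=
  forall i, geodesic_segment (v i) (v (ordS i)) (S i).

Definition comparison_triangle (R : realType) (X : metricType R)
    (v : 'I_3 -> X) (w : 'I_3 -> 'rV[R]_2) : Prop :=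
  forall i j, eucl_dist (w i) (w j) = mdist (v i) (v j).

(* [a'] is the comparison point, on the side of [w] starting at [w i],
   of the point [a] of the corresponding side of the triangle [v]. *)
Definition comparison_point (R : realType) (X : metricType R)
    (v : 'I_3 -> X) (w : 'I_3 -> 'rV[R]_2) (i : 'I_3)
    (a : X) (a' : 'rV[R]_2) : Prop :=
  eucl_segment (w i) (w (ordS i)) a' /\ eucl_dist (w i) a' = mdist (v i) a.

Definition CAT0 (R : realType) (X : metricType R) : Prop :=
  geodesic_space X /\
  forall (v : 'I_3 -> X) (S : 'I_3 -> set X) (w : 'I_3 -> 'rV[R]_2),
    geodesic_triangle v S -> comparison_triangle v w ->
    forall (i j : 'I_3) (a b : X) (a' b' : 'rV[R]_2),
      S i a -> S j b ->
      comparison_point v w i a a' -> comparison_point v w j b b' ->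
      mdist a b <= eucl_dist a' b'.

(* Geodesic segments are unique in a CAT(0) space, so quantifying over all
   segments from [x] to [y] is the condition on [x, y]. *)
Definition geodesically_convex (R : realType) (X : metricType R)
    (C : set X) : Prop :=
  forall x y, C x -> C y -> forall S, geodesic_segment x y S -> S `<=` C.

(* A pair [ab : X * X] stands for the vector from [ab.1] to [ab.2]. *)
Definition quasilin (R : realType) (X : metricType R) (ab cd : X * X) : R :=
  2^-1 * (mdist ab.1 cd.2 ^+ 2 + mdist ab.2 cd.1 ^+ 2
          - mdist ab.1 cd.1 ^+ 2 - mdist ab.2 cd.2 ^+ 2).

Definition nearest_point (R : realType) (X : metricType R)
    (C : set X) (x u : X) : Prop :=
  C u /\ forall y, C y -> mdist x u <= mdist x y.

Definition is_metric_projection (R : realType) (X : metricType R)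
    (C : set X) (x u : X) : Prop :=
  nearest_point C x u /\ forall v, nearest_point C x v -> v = u.

(* Main.v *)
Require Import Defs.
From mathcomp Require Import all_boot all_order all_algebra.
From mathcomp Require Import classical_sets reals topology.
From mathcomp Require Import ring lra.

(** The variational inequality unfolds to the obtuse-angle form of Pythagoras,
    [d(x, u)^2 + d(u, y)^2 <= d(x, y)^2] ([quasilin_shared_vertex]).  If it
    holds for all [y] in [C], it bounds [d(x, u)] by [d(x, y)], and equality of
    these distances forces [d(u, y) = 0]: this gives minimality and uniqueness
    together.

    Conversely, let [u] be nearest to [x], let [y] be in [C], and move from [u]
    towards [y] by a fraction [t] of the way.  By convexity the point reached
    stays in [C], hence is no closer to [x] than [u], while the CAT(0) form of
    Stewart's identity ([CAT0_stewart]) bounds its squared distance to [x] by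
    [(1 - t) d(x, u)^2 + t d(x, y)^2 - t (1 - t) d(u, y)^2].  Dividing by [t]
    leaves [0 <= d(x, y)^2 - d(x, u)^2 - d(u, y)^2 + t d(u, y)^2], and letting
    [t] tend to 0 ([ge0_affine_limit]) gives the inequality.

    Stewart's inequality is thinness applied to one vertex and one point of the
    opposite side.  Thinness speaks about a given comparison triangle, so one
    has to be built: one side is laid on the first axis, and the abscissa of
    the third vertex is dictated by the law of cosines
    ([law_of_cosines_projection]). *)

Import Order.TTheory GRing.Theory Num.Theory.

Local Open Scope ring_scope.
Local Open Scope classical_set_scope.

Definition plane_point {R : realType} (p q : R) : 'rV[R]_2 :=
  \row_(i < 2) (if i == ord0 then p else q).

Lemma eucl_dist_plane_point {R : realType} (p q p' q' : R) :
  eucl_dist (plane_point p q) (plane_point p' q') =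
  Num.sqrt ((p - p') ^+ 2 + (q - q') ^+ 2).
Proof. by rewrite /eucl_dist !big_ord_recl big_ord0 !mxE /= addr0. Qed.

Lemma eucl_dist_sym {R : realType} (a b : 'rV[R]_2) :
  eucl_dist a b = eucl_dist b a.
Proof. by congr Num.sqrt; apply: eq_bigr => i _; rewrite -sqrrN opprB. Qed.

Lemma eucl_dist_refl {R : realType} (a : 'rV[R]_2) : eucl_dist a a = 0.
Proof.
by rewrite /eucl_dist big1 ?sqrtr0// => i _; rewrite subrr expr0n.
Qed.

(** [p] is the signed length of the projection of the side of length [r] on the
    line of the side of length [l].  The triangle inequalities make
    [r ^+ 2 - p ^+ 2] nonnegative, so that the height of the triangle exists.
    The defining equation is kept free of division to cover degenerate
    triangles with [l = 0]. *)
Lemma law_of_cosines_projection {R : realType} (l r s : R) :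
  0 <= l -> 0 <= r -> 0 <= s -> l <= r + s -> r <= l + s -> s <= l + r ->
  exists2 p, 2 * l * p = r ^+ 2 + l ^+ 2 - s ^+ 2 & p ^+ 2 <= r ^+ 2.
Proof.
rewrite le0r => /orP[/eqP->|l0] r0 s0 hl hr hs.
  exists 0; last by rewrite expr0n /= sqr_ge0.
  have -> : r = s by lra.
  by rewrite mulr0; ring.
pose p := (r ^+ 2 + l ^+ 2 - s ^+ 2) / (2 * l).
have pE : 2 * l * p = r ^+ 2 + l ^+ 2 - s ^+ 2.
  by rewrite /p; field; rewrite gt_eqF.
exists p => //.
(* [l (r - p)] and [l (r + p)] are, up to a factor 2, the products of triangle
   defects of Heron's formula. *)
have [pr prN] : p <= r /\ - r <= p.
  split; rewrite -subr_ge0 -(pmulr_rge0 _ l0).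
    have -> : l * (r - p) = (s - l + r) * (s + l - r) / 2 by lra.
    by rewrite divr_ge0// mulr_ge0//; lra.
  have -> : l * (p - - r) = (r + l - s) * (r + l + s) / 2 by lra.
  by rewrite divr_ge0// mulr_ge0//; lra.
by rewrite -subr_ge0 subr_sqr mulr_ge0//; lra.
Qed.

Lemma ge0_affine_limit {R : realType} (D L : R) :
  0 <= L -> (forall t, 0 < t <= 1 -> 0 <= D + t * L) -> 0 <= D.
Proof.
move=> L0 h; rewrite leNgt; apply/negP => D0.
have LD : 0 < L - D by lra.
(* At this [t] the affine function takes the value [t * D]. *)
pose t := - D / (L - D).
have tE : t * (L - D) = - D by rewrite /t divfK// gt_eqF.
have t0 : 0 < t by rewrite divr_gt0// oppr_gt0.
have t1 : t <= 1 by rewrite ler_pdivrMr//; lra.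
have tD : D + t * L = t * D by lra.
by have := h t; rewrite t0 t1 tD leNgt pmulr_rlt0// D0 => /(_ isT).
Qed.

Lemma sqrtr_eq_sqr {R : realType} (a b : R) :
  0 <= b -> a = b ^+ 2 -> Num.sqrt a = b.
Proof. by move=> b0 ->; rewrite sqrtr_sqr ger0_norm. Qed.

(** In the plane Stewart's theorem is an equality; thinness of the triangle
    [a, b, x], applied to the vertex [x] and a point of the side from [a] to
    [b], turns it into an upper bound. *)
Lemma CAT0_stewart {R : realType} {X : metricType R} (hX : CAT0 X)
    (x a b : X) (c : R -> X) (t : R) :
  geodesic_path c a b -> 0 <= t <= 1 ->
  mdist x (c (t * mdist a b)) ^+ 2 <=
    (1 - t) * mdist x a ^+ 2 + t * mdist x b ^+ 2
    - t * (1 - t) * mdist a b ^+ 2.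
Proof.
move=> gc /andP[t0 t1]; have [c0 c1 cd] := gc.
case: hX => geoX cat0X.
set l := mdist a b; set r := mdist a x; set s := mdist b x.
have l0 : 0 <= l by exact: mdist_ge0.
have r0 : 0 <= r by exact: mdist_ge0.
have s0 : 0 <= s by exact: mdist_ge0.
have [p pE pr] : exists2 p, 2 * l * p = r ^+ 2 + l ^+ 2 - s ^+ 2
                          & p ^+ 2 <= r ^+ 2.
  apply: law_of_cosines_projection => //.
  - by have := metric_triangle a x b; rewrite (metric_sym x b).
  - by have := metric_triangle a b x.
  - by have := metric_triangle b a x; rewrite (metric_sym b a).
pose q := Num.sqrt (r ^+ 2 - p ^+ 2).
have qE : q ^+ 2 = r ^+ 2 - p ^+ 2 by rewrite sqr_sqrtr// subr_ge0.
have [S1 gS1] := geoX b x; have [S2 gS2] := geoX x a.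
have tl : 0 <= t * l <= l by rewrite mulr_ge0//= ler_piMl.
(* The comparison triangle has [a] at the origin and [b] on the first axis; the
   defaults of [nth] are never reached. *)
pose v (i : 'I_3) := nth x [:: a; b; x] i.
pose S (i : 'I_3) := nth S1 [:: c @` `[0, l]; S1; S2] i.
pose w (i : 'I_3) :=
  nth (plane_point 0 0) [:: plane_point 0 0; plane_point l 0; plane_point p q] i.
have gS : geodesic_triangle v S.
  by case=> [[|[|[|//]]] ?] //=; exists c.
have wab : eucl_dist (plane_point 0 0) (plane_point l 0) = l.
  by rewrite eucl_dist_plane_point; apply: sqrtr_eq_sqr => //; ring.
have wax : eucl_dist (plane_point 0 0) (plane_point p q) = r.
  by rewrite eucl_dist_plane_point; apply: sqrtr_eq_sqr => //; lra.
have wbx : eucl_dist (plane_point l 0) (plane_point p q) = s.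
  by rewrite eucl_dist_plane_point; apply: sqrtr_eq_sqr => //; lra.
have cw : comparison_triangle v w.
  case=> [[|[|[|//]]] ?] [[|[|[|//]]] ?]; rewrite /v /w /=
    ?eucl_dist_refl ?mdistxx// eucl_dist_sym 1?metric_sym ?wab ?wax ?wbx //.
have := cat0X v S w gS cw ord0 ord_max (c (t * l)) x
  (plane_point (t * l) 0) (plane_point p q).
rewrite eucl_dist_plane_point => /(_ _ _ _ _) le_comp.
have {le_comp} : mdist (c (t * l)) x <=
    Num.sqrt ((t * l - p) ^+ 2 + (0 - q) ^+ 2).
  apply: le_comp.
  - by exists (t * l) => //=; rewrite in_itv.
  - case: gS2 => c' [c'0 _ _] S2E; rewrite /S /= S2E; exists 0 => //=.
    by rewrite in_itv /= lexx mdist_ge0.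
  (* The comparison point of [c (t * l)] is [(t * l, 0)]. *)
  - split.
      exists t; first by rewrite /= in_itv /= t0.
      apply/rowP => i; rewrite !mxE /=.
      by case: ifP => _; rewrite ?mulr0 ?addr0 ?add0r.
    rewrite /v /w /= eucl_dist_plane_point -[in RHS]c0 cd ?lexx//.
    by rewrite subrr expr0n addr0 sqrtr_sqr.
  (* The vertex [x] is the starting point of the third side, from [x] to [a]. *)
  - split.
      exists 0; first by rewrite /= in_itv /= lexx ler01.
      by rewrite subr0 scale1r scale0r addr0.
    by rewrite eucl_dist_refl mdistxx.
rewrite metric_sym => /(lerXn2r 2 (mdist_ge0 _ _) (sqrtr_ge0 _)).
rewrite sqr_sqrtr ?addr_ge0 ?sqr_ge0// => /le_trans; apply.
rewrite (metric_sym x a) (metric_sym x b) -/r -/s sub0r sqrrN qE.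
(* Stewart's theorem in coordinates: the only nonlinear input is the law of
   cosines multiplied by [t]. *)
have : t * (2 * l * p) = t * (r ^+ 2 + l ^+ 2 - s ^+ 2) by rewrite pE.
lra.
Qed.

Lemma quasilin_shared_vertex {R : realType} {X : metricType R} (x u y : X) :
  quasilin (x, u) (u, y) =
  2^-1 * (mdist x y ^+ 2 - mdist x u ^+ 2 - mdist u y ^+ 2).
Proof. by rewrite /quasilin /= mdistxx; ring. Qed.

Theorem theorem2p2 (R : realType) (X : metricType R) (hX : CAT0 X)
    (C : set X) (C0 : C !=set0) (hC : geodesically_convex C)
    (x u : X) (uC : C u) :
  is_metric_projection C x u <->
  forall y : X, C y -> 0 <= quasilin (x, u) (u, y).
Proof.
split=> [[[_ umin] _] y Cy|hq].
  rewrite quasilin_shared_vertex pmulr_rge0 ?invr_gt0//.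
  have [S gS] := hX.1 u y; have SC := hC u y uC Cy S gS.
  case: gS => c gc SE.
  apply: (ge0_affine_limit _ (mdist u y ^+ 2)); first exact: sqr_ge0.
  move=> t /andP[t0 t1]; rewrite -(pmulr_rge0 _ t0).
  have zC : C (c (t * mdist u y)).
    apply: SC; rewrite SE; exists (t * mdist u y) => //=.
    by rewrite in_itv /= mulr_ge0 ?ler_piMl ?mdist_ge0// ltW.
  have := lerXn2r 2 (mdist_ge0 _ _) (mdist_ge0 _ _) (umin _ zC).
  have := CAT0_stewart hX x u y c t gc; rewrite (ltW t0) t1 => /(_ isT).
  lra.
have pyth y : C y -> mdist x u ^+ 2 + mdist u y ^+ 2 <= mdist x y ^+ 2.
  by move=> /hq; rewrite quasilin_shared_vertex pmulr_rge0 ?invr_gt0//; lra.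
have umin : nearest_point C x u.
  split=> // y /pyth h; rewrite -ler_sqr ?nnegrE ?mdist_ge0//.
  by apply: le_trans h; rewrite lerDl sqr_ge0.
split=> // v [Cv vmin]; apply/esym/mdist_positivity/eqP.
rewrite -sqrf_eq0 eq_le sqr_ge0 andbT.
have := lerXn2r 2 (mdist_ge0 _ _) (mdist_ge0 _ _) (vmin u uC).
by have := pyth v Cv; lra.
Qed.
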